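(* Let $\mathfrak U$ be the unfolding of a system $M$ under an unconditional independence relation $I$, assumed finite, and let $\tilde C$ be a maximal configuration of $\mathfrak U$. Then in any execution of the procedure Explore described below (started with $\mathrm{Explore}(\{\bot\},\emptyset,\emptyset)$), $\mathrm{Explore}$ is called at most once with first argument equal to $\tilde C$.
   Context: $\mathfrak U=(E,<,\#,h)$ is a labelled event structure (causality $<$ a strict partial order with finite down-sets, conflict $\#$ symmetric irreflexive and inherited along $<$) with a special minimal event $\bot$; a configuration is a finite causally closed conflict-free set of events; $[e]=\{e'\le e\}$, $\lceil e\rceil=\{e'<e\}$; $e\#_ie'$ (immediate conflict) if $e\#e'$ and both $\lceil e\rceil\cup[e']$ and $[e]\cup\lceil e'\rceil$ are configurations. For a configuration $C$: $\mathrm{ex}(C)=\{e\notin C:\lceil e\rceil\subseteq C\}$, $\mathrm{en}(C)=\{e\in\mathrm{ex}(C):C\cup\{e\}\text{ is a configuration}\}$. For $U\subseteq E$, $\#_U(e)=\{e'\in U:e\#_ie'\}$. Given $U$, a configuration $C\subseteq U$ and $D\subseteq U$, an alternative to $D$ after $C$ is a configuration $J\subseteq U$ such that $C\cup J$ is a configuration and for every $e\in D$ some $e'\in C\cup J$ lies in $\#_U(e)$; $\mathrm{Alt}(X,Y)$ is the set of all alternatives (w.r.t. the current global $U$) to $Y$ after $X$. $Q_{C,D,U}=C\cup D\cup\bigcup_{e\in C\cup D,\,e'\in\#_U(e)}[e']$. Algorithm: global sets $U$ (initially $\{\bot\}$) and $G$ (initially $\emptyset$). $\mathrm{Explore}(C,D,A)$: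 (1) add $\mathrm{ex}(C)$ to $U$; (2) if $\mathrm{en}(C)\cap U=\emptyset$, return; (3) if $A=\emptyset$ choose any $e\in\mathrm{en}(C)\cap U$, else any $e\in A\cap\mathrm{en}(C)\cap U$; (4) call $\mathrm{Explore}(C\cup\{e\},D,A\setminus\{e\})$; (5) if some $J\in\mathrm{Alt}(C,D\cup\{e\})$ exists, call $\mathrm{Explore}(C,D\cup\{e\},J\setminus C)$; (6) move $\{e\}\setminus Q_{C,D,U}$ from $U$ to $G$ and, for each $\hat e\in\#_U(e)$, move $[\hat e]\setminus Q_{C,D,U}$ from $U$ to $G$. *)

(* Defs.v *)
From HB Require Import structures.
From mathcomp Require Import all_boot.
From mathcomp Require Import finmap.
From mathcomp Require Import boolp classical_sets functions cardinality.

Set Implicit Arguments.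
Unset Strict Implicit.
Unset Printing Implicit Defensive.

Local Open Scope classical_set_scope.

(* [act M t] is the partial function on states denoted by the transition [t]. *)
Record system (T : Type) := System {
  global_state : Type;
  init : global_state;
  act : T -> global_state -> option global_state
}.

Section Systems.
Variables (T : Type) (M : system T).

Definition enabled (t : T) (s : global_state M) : bool := isSome (act t s).

Fixpoint run (w : seq T) (s : global_state M) : option (global_state M) :=
  if w is t :: w' then obind (run w') (act t s) else Some s.

Definition reachable (s : global_state M) : Prop :=
  exists w, run w (init M) = Some s.

Definition commute (t t' : T) (s : global_state M) : Prop :=
  (forall s', act t s = Some s' -> enabled t' s = enabled t' s') /\
  (enabled t s -> enabled t' s ->
    exists s', run [:: t; t'] s = Some s' /\ run [:: t'; t] s = Some s').

Definition unconditional_independence (I : rel T) : Prop :=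
  [/\ symmetric I, irreflexive I &
      forall t t', I t t' -> forall s, reachable s -> commute t t' s].

End Systems.

Record les (X L : Type) := Les {
  ev : set X;
  lt : X -> X -> Prop;
  cf : X -> X -> Prop;
  lab : X -> L
}.

Section EventStructures.
Variables (X L : Type) (E : les X L).

(* [les] is raw data; the unfolding satisfies these laws: [unfolding_is_les]. *)
Definition is_les : Prop :=
  [/\ (forall x y, lt E x y -> ev E x /\ ev E y),
      (forall x y, cf E x y -> ev E x /\ ev E y),
      (forall x, ~ lt E x x) /\
        (forall x y z, lt E x y -> lt E y z -> lt E x z),
      (forall x, ~ cf E x x) /\ (forall x y, cf E x y -> cf E y x) &
      (forall x, ev E x -> finite_set [set y | lt E y x]) /\
        (forall x y z, cf E x y -> lt E y z -> cf E x z)].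

Definition causes (e : X) : set X := [set e' | lt E e' e].

Definition local_config (e : X) : set X := causes e `|` [set e].

Definition config (C : set X) : Prop :=
  [/\ finite_set C,
      C `<=` ev E,
      (forall e, C e -> causes e `<=` C) &
      (forall e e', C e -> C e' -> ~ cf E e e')].

Definition maximal_config (C : set X) : Prop :=
  config C /\ forall C', config C' -> C `<=` C' -> C' = C.

Definition imm_cf (e e' : X) : Prop :=
  [/\ cf E e e',
      config (causes e `|` local_config e') &
      config (local_config e `|` causes e')].

Definition ex (C : set X) : set X :=
  [set e | [/\ ev E e, ~ C e & causes e `<=` C]].

Definition en (C : set X) : set X :=
  [set e | ex C e /\ config (C `|` [set e])].

Definition imm_cf_in (U : set X) (e : X) : set X :=
  [set e' | U e' /\ imm_cf e e'].

Definition Alt (U C D : set X) : set (set X) :=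
  [set J | [/\ config J, J `<=` U, config (C `|` J) &
    forall e, D e -> exists e', (C `|` J) e' /\ imm_cf_in U e e']].

Definition Q (C D U : set X) : set X :=
  C `|` D `|`
  \bigcup_(e in C `|` D) \bigcup_(e' in imm_cf_in U e) local_config e'.

End EventStructures.

(* Canonical event names: [Bot], and [<t, H>] for a transition [t] and a
   finite set of events [H].  A finite set is stored as the sequence of its
   elements; only the canonical enumerations used by [occ] below ever occur, so
   that [occ t H = occ t' H'] iff [t = t'] and [H = H']. *)
Inductive event (T : Type) := Bot | Ev of T & seq (event T).
Arguments Bot {T}.

Section EventChoice.
Variable T : choiceType.

Fixpoint event_encode (e : event T) : GenTree.tree T :=
  match e with
  | Bot => GenTree.Node 0 [::]
  | Ev t s => GenTree.Node 1 (GenTree.Leaf t :: map event_encode s)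
  end.

Fixpoint event_decode (x : GenTree.tree T) : event T :=
  match x with
  | GenTree.Node _ (GenTree.Leaf t :: s) => Ev t (map event_decode s)
  | _ => Bot
  end.

Lemma event_encodeK : cancel event_encode event_decode.
Proof.
rewrite /cancel; fix IH 1; case=> [|t s] //=; congr Ev.
by elim: s => [//|e s IHs] /=; rewrite IH IHs.
Qed.

HB.instance Definition _ := Choice.copy (event T) (can_type event_encodeK).

End EventChoice.

Section Unfolding.
Variables (T : choiceType) (M : system T) (I : rel T).

Definition occ (t : T) (H : {fset event T}) : event T := Ev t (enum_fset H).

(* [None] plays the role of the empty label of [Bot]. *)
Definition label (e : event T) : option T := if e is Ev t _ then Some t else None.

Definition ules := les (event T) (option T).

(* Since [Bot] has the empty label, it is skipped when reading off labels. *)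
Definition interleaving (E : ules) (C : set (event T)) (w : seq T) : Prop :=
  exists l : seq (event T),
    [/\ uniq l, [set` l] = C,
        (forall x y, C x -> C y -> lt E x y -> index x l < index y l)%N &
        w = pmap (lab E) l].

(* Under an unconditional independence, all interleavings of a configuration
   of a prefix lead to the same state. *)
Definition state_of (E : ules) (C : set (event T)) (s : global_state M) : Prop :=
  exists w, interleaving E C w /\ run w (init M) = Some s.

Definition dependent (e : event T) (t : T) : Prop :=
  exists2 t', label e = Some t' & ~~ I t' t.

(* Requiring [Bot] rules out the empty configuration, whose set of maximal
   events is empty: every event other than [Bot] has [Bot] as a cause. *)
Definition history (E : ules) (t : T) (H : {fset event T}) : Prop :=
  [/\ config E [set` H],
      Bot \in H,
      (exists s, state_of E [set` H] s /\ enabled t s) &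
      [set` H] = [set Bot] \/
      (forall e, e \in H -> (forall e', e' \in H -> ~ lt E e e') ->
         dependent e t)].

(* The least symmetric relation inherited along causality. *)
Inductive conflict_closure (ltX R : event T -> event T -> Prop) :
    event T -> event T -> Prop :=
| cc_base x y : R x y -> conflict_closure ltX R x y
| cc_sym x y : conflict_closure ltX R x y -> conflict_closure ltX R y x
| cc_inh x y z :
    conflict_closure ltX R x y -> ltX y z -> conflict_closure ltX R x z.

(* The events of [E] in conflict with a new event [occ t H]: dependent and
   causally unrelated.  Being new, [occ t H] causes no event of [E]. *)
Definition new_conflicts (E : ules) (t : T) (H : {fset event T}) :
    set (event T) :=
  [set e' | [/\ ev E e', e' \notin H & dependent e' t]].

Definition extend_lt (E : ules) (t : T) (H : {fset event T})
    (x y : event T) : Prop :=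
  lt E x y \/ (x \in H /\ y = occ t H).

Definition extend (E : ules) (t : T) (H : {fset event T}) : ules :=
  Les (ev E `|` [set occ t H])
    (extend_lt E t H)
    (conflict_closure (extend_lt E t H)
      (fun x y => cf E x y \/ (x = occ t H /\ new_conflicts E t H y)))
    label.

Definition bot_les : ules :=
  Les [set Bot] (fun _ _ => False) (fun _ _ => False) label.

Inductive finite_prefix : ules -> Prop :=
| prefix_bot : finite_prefix bot_les
| prefix_extend E t H :
    finite_prefix E -> history E t H -> ~ ev E (occ t H) ->
    finite_prefix (extend E t H).

(* The union of all finite prefixes; it need not be finite. *)
Definition unfolding : ules :=
  Les [set e | exists2 P, finite_prefix P & ev P e]
    (fun x y => exists2 P, finite_prefix P & lt P x y)
    (fun x y => exists2 P, finite_prefix P & cf P x y)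
    label.

End Unfolding.

Section UnfoldingIsLes.
Variables (T : choiceType) (M : system T) (I : rel T) (Isym : symmetric I).
Implicit Types (x y z e : event T) (E P : ules T).

Local Notation prefix := (finite_prefix M I).

Local Definition past e : seq (event T) := if e is Ev _ s then s else [::].
Local Definition below x y := x = y \/ x \in past y.
Local Definition dep x y := exists t t', [/\ label x = Some t, label y = Some t' & ~~ I t t'].
Local Definition clash x y := exists x' y',
  [/\ below x' x, below y' y, dep x' y', ~ below x' y' & ~ below y' x'].

Local Lemma clash_sym x y : clash x y -> clash y x.
Proof.
move=> [x' [y' [? ? [t [t' [? ? It]]] ? ?]]]; exists y', x'; split=> //.
by exists t', t; rewrite Isym.
Qed.

Local Lemma prefix_lab P : prefix P -> lab P = @label T.
Proof. by case. Qed.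

Local Lemma bot_in_prefix P : prefix P -> ev P Bot.
Proof. by elim=> [|E t H _ EB _ _] //=; left. Qed.

Local Lemma prefix_lt P : prefix P ->
  [/\ (forall x y, lt P x y <-> ev P y /\ x \in past y),
      (forall x y, ev P y -> x \in past y -> ev P x),
      (forall x y z, ev P z -> x \in past y -> y \in past z -> x \in past z) &
      (forall x, ev P x -> x \notin past x)].
Proof.
elim=> [|E t H _ [ltE downE trE irE] [[_ HE Hdown _] _ _ _] newE] /=.
  by split=> [x y|x y|x y z|x] => [|->|-> |->] //; split=> // -[-> ].
have pastH x : (x \in past (occ t H)) = (x \in H) by [].
split=> [x y|x y|x y z|x].
- split=> [[/ltE[Ey xy]|[xH ->]]|[[Ey|->] xy]].
  + by split=> //; left.
  + by split=> //; right.
  + by left; apply/ltE.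
  + by right.
- move=> [Ey|->] xy; left; first exact: downE xy.
  exact: HE.
- move=> [Ez|->] xy yz; first exact: trE Ez xy yz.
  rewrite pastH in yz *; apply: (Hdown _ yz); apply/ltE; split=> //.
  exact: HE.
- move=> [|->]; first exact: irE.
  by rewrite pastH; apply/negP => /HE.
Qed.

Local Lemma prefix_cf P : prefix P ->
  (forall x, ev P x -> ~ clash x x) /\
  (forall x y, cf P x y <-> [/\ ev P x, ev P y & clash x y]).
Proof.
elim=> [|E t H pE [irE cfE] hH newE].
  split=> /= [x -> |x y]; first by
    move=> [x' [y' [[->|//] [->|//] [t [t' []]]]]].
  by split=> // -[-> -> [x' [y' [[->|//] [->|//] [t [t' []]]]]]].
have pX := prefix_extend pE hH newE.
have [ltE downE _ _] := prefix_lt pE.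
have [ltX downX trX irX] := prefix_lt pX.
case: hH => -[_ HE Hdown Hcf] _ _ _.
set e := occ t H in newE pX ltX downX trX irX *.
have below_e x : below x e -> x = e \/ x \in H by [].
have irX' x : ev (extend I E t H) x -> ~ clash x x.
  move=> [|->]; first exact: irE.
  move=> [x' [y' [/below_e[->|x'H] y'e dxy nxy nyx]]]; first exact: nyx.
  case: (below_e _ y'e) => [yE|y'H]; first by apply: nxy; rewrite yE; right.
  apply: (Hcf _ _ x'H y'H); apply/cfE; split; [exact: HE|exact: HE|].
  by exists x', y'; split=> //; left.
split=> // x y; split.
  elim=> {x y} [x y [/cfE[Ex Ey xy]|[-> [Ey yH [t' ty It]]]]|x y _ [Ex Ey xy]|
               x y z _ [Ex Ey xy] yz].
  - by split=> //; left.
  - split; [by right|by left|exists e, y; split; try by left].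
    + by exists t, t'; rewrite Isym.
    + by move=> [ey|/(downE _ _ Ey)//]; apply: newE; rewrite ey.
    + by move=> [ye|]; [apply: newE; rewrite -ye|exact/negP].
  - by split=> //; apply: clash_sym.
  - have /ltX[Ez yz'] := yz; split=> //.
    case: xy => x' [y' [xx' yy' d n1 n2]]; exists x', y'; split=> //.
    case: yy' => [->|y'y]; first by right.
    by right; apply: trX y'y yz'.
have mixed y' : ev E y' -> clash e y' ->
    cf (extend I E t H) e y'.
  move=> Ey [x1 [y1 [/below_e[->|x1H] yy1 [t1 [t2 [l1 l2 It]]] n1 n2]]].
    have Ey1 : ev E y1 by case: yy1 => [->|/downE]//; apply.
    have c : cf (extend I E t H) e y1.
      apply: cc_base; right; split=> //; split=> //.
        by apply/negP => y1H; apply: n2; right.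
      by exists t2 => //; move: l1 It => [->]; rewrite Isym.
    case: yy1 => [<-//|y1y]; apply: cc_inh c _.
    by left; apply/ltE.
  apply: cc_sym; apply: (@cc_inh _ _ _ _ x1); last by right.
  apply: cc_sym; apply: cc_base; left; apply/cfE; split=> //; first exact: HE.
  by exists x1, y1; split=> //; [left|exists t1, t2].
move=> [[Ex|->] [Ey|->] xy].
- by apply: cc_base; left; apply/cfE.
- by apply: cc_sym; apply: mixed => //; apply: clash_sym.
- exact: mixed.
- by case: (irX' e) => //; right.
Qed.

Local Lemma prefix_union P P' : prefix P -> prefix P' ->
  exists2 P'', prefix P'' & ev P'' = ev P `|` ev P'.
Proof.
move=> pP; elim=> [|E t H pE [R pR RE] hH newE].
  exists P => //=; apply/seteqP; split=> x; first by left.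
  by move=> [//|->]; apply: bot_in_prefix.
have [Re|nRe] := pselect (ev R (occ t H)).
  exists R => //=; rewrite setUA -RE; apply/seteqP; split=> x; first by left.
  by move=> [//|->].
exists (extend I R t H); last by rewrite /= RE setUA.
apply: prefix_extend => //.
have ER x : ev E x -> ev R x by rewrite RE; right.
have [[ltE _ _ _] [_ cfE]] := (prefix_lt pE, prefix_cf pE).
have [[ltR _ _ _] [_ cfR]] := (prefix_lt pR, prefix_cf pR).
case: hH => -[fH HE Hdown Hcf] HB [s [[w [[l [ul lH ll lw]] rw]] ts]] Hmax.
have ltRE x y : y \in H -> lt R x y <-> lt E x y.
  move=> /HE Ey; split=> [/ltR[_ xy]|/ltE[_ xy]]; first exact/ltE.
  by apply/ltR; split=> //; apply: ER.
split=> //.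
- split=> //.
  + by move=> x /HE /ER.
  + by move=> x xH y /(ltRE _ _ xH); apply: Hdown.
  + move=> x y xH yH /cfR[_ _ xy]; apply: (Hcf x y) => //.
    by apply/cfE; split=> //; apply: HE.
- exists s; split=> //; exists w; split=> //; exists l; split=> //.
    by move=> x y xH yH /(ltRE _ _ yH); apply: ll.
  by rewrite lw (prefix_lab pE) (prefix_lab pR).
- case: Hmax => [->|Hmax]; [by left|right=> x xH xmax; apply: Hmax => //].
  by move=> y yH /(ltRE _ _ yH); apply: xmax.
Qed.

Lemma unfolding_is_les : is_les (unfolding M I).
Proof.
split=> /=.
- move=> x y [P pP xy]; have [ltP downP _ _] := prefix_lt pP.
  by have /ltP[Py xy'] := xy; split; exists P => //; apply: downP xy'.
- by move=> x y [P pP /(prefix_cf pP).2[Px Py _]]; split; exists P.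
- split=> [x [P pP xx]|x y z [P pP xy] [P' pP' yz]].
    have [ltP _ _ irP] := prefix_lt pP.
    by have /ltP[Px] := xx; apply/negP/irP.
  have [[ltP _ _ _] [ltP' downP' trP' _]] := (prefix_lt pP, prefix_lt pP').
  have [/ltP[_ xy'] /ltP'[Pz yz']] := (xy, yz).
  by exists P' => //; apply/ltP'; split=> //; apply: trP' xy' yz'.
- split=> [x [P pP /(prefix_cf pP).2[Px _]]|x y [P pP xy]].
    exact: (prefix_cf pP).1.
  exists P => //; apply/(prefix_cf pP).2.
  have /(prefix_cf pP).2[Px Py ?] := xy; split=> //; exact: clash_sym.
- split=> [x _|x y z [P pP xy] [P' pP' yz]].
    apply: (@sub_finite_set _ _ [set` past x]); last exact: finite_seq.
    by move=> y [P /prefix_lt[ltP _ _ _] /ltP[]].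
  have [R pR RE] := prefix_union pP pP'; exists R => //.
  have [[ltP' _ _ _] [ltR _ trR _]] := (prefix_lt pP', prefix_lt pR).
  have /ltP'[Pz yz'] := yz; have /(prefix_cf pP).2[Px Py xy'] := xy.
  have Rz : ev R z by rewrite RE; right.
  apply/(prefix_cf pR).2; split=> //; first by rewrite RE; left.
  case: xy' => x' [y' [xx' yy' d n1 n2]]; exists x', y'; split=> //.
  case: yy' => [->|y'y]; first by right.
  by right; apply: trR y'y yz'.
Qed.

End UnfoldingIsLes.

Section Exploration.
Variables (X L : Type) (E : les X L) (bot : X).

(* The pending work of the recursive procedure, as a stack of frames:
   [Call C D A] is a call that has been made and whose body has not started,
   [AfterLeft C D e] is an activation of [Explore(C,D,_)] that chose [e], once
   its first recursive call has returned, and [AfterRight C D e] is such an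
   activation about to clean up. *)
Inductive frame :=
| Call of set X & set X & set X
| AfterLeft of set X & set X & X
| AfterRight of set X & set X & X.

(* [calls] records the first argument of every call made so far. *)
Record exploration := Exploration {
  glob_U : set X;
  glob_G : set X;
  stack : seq frame;
  calls : seq (set X)
}.

Definition start : exploration :=
  Exploration [set bot] set0 [:: Call [set bot] set0 set0] [:: [set bot]].

(* [Q E C D U] is not affected by removing from [U] events outside of it, and
   the elements of [imm_cf_in E U e] are pairwise causally unrelated, so moving
   the events at once or one local configuration at a time is the same. *)
Definition removed (U C D : set X) (e : X) : set X :=
  ([set e] `|` \bigcup_(e' in imm_cf_in E U e) local_config E e')
    `\` Q E C D U.

Inductive step : exploration -> exploration -> Prop :=
| step_return U G C D A k cs :
    en E C `&` (U `|` ex E C) = set0 ->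
    step (Exploration U G (Call C D A :: k) cs)
         (Exploration (U `|` ex E C) G k cs)
| step_left U G C D A k cs e :
    (en E C `&` (U `|` ex E C)) e ->
    A = set0 \/ A e ->
    step (Exploration U G (Call C D A :: k) cs)
         (Exploration (U `|` ex E C) G
            (Call (C `|` [set e]) D (A `\ e) :: AfterLeft C D e :: k)
            (rcons cs (C `|` [set e])))
| step_right U G C D e k cs J :
    Alt E U C (D `|` [set e]) J ->
    step (Exploration U G (AfterLeft C D e :: k) cs)
         (Exploration U G
            (Call C (D `|` [set e]) (J `\` C) :: AfterRight C D e :: k)
            (rcons cs C))
| step_no_right U G C D e k cs :
    Alt E U C (D `|` [set e]) = set0 ->
    step (Exploration U G (AfterLeft C D e :: k) cs)
         (Exploration U G (AfterRight C D e :: k) cs)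
| step_remove U G C D e k cs :
    step (Exploration U G (AfterRight C D e :: k) cs)
         (Exploration (U `\` removed U C D e)
            (G `|` (U `&` removed U C D e)) k cs).

(* Terminated or not: the states reached in the course of some execution. *)
Inductive execution : exploration -> Prop :=
| execution_start : execution start
| execution_step s s' : execution s -> step s s' -> execution s'.

End Exploration.

(* Main.v *)
Require Import Defs.
From mathcomp Require Import all_boot.
From mathcomp Require Import boolp classical_sets functions cardinality.

(** In every call [Explore(C,D,A)] the set [C ∪ A] is conflict-free and contains,
    for each event of [D], an event in conflict with it.  So [D] is disjoint from
    [C], and from the first argument of every later call of that activation,
    since [D] only grows.  Hence the two recursive calls of an activation that
    chose [e] lead to disjoint families of configurations: those of the left
    subtree contain [e], those of the right one do not.  A call on the maximal
    configuration [Ct] is a leaf.  Therefore the number of calls on [Ct] so far,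
    plus the number of frames of the stack that may still lead to [Ct], never
    increases. *)

Set Implicit Arguments.
Unset Strict Implicit.
Unset Printing Implicit Defensive.

Local Open Scope classical_set_scope.

Section AtMostOnce.
Variables (X L : Type) (E : les X L) (Ct : set X).
Implicit Types (C D A J U : set X) (e : X) (f : frame X) (s : exploration X).

Definition conflict_free C : Prop := forall x y, C x -> C y -> ~ cf E x y.

Definition in_conflict_with D C : Prop :=
  forall x, D x -> exists2 y, C y & cf E x y.

(** Once [e] is chosen, its enabledness at [C] is kept to rule out [C = Ct] when the right call
    records [C] again. *)
Definition wf_frame f : Prop :=
  match f with
  | Call C D A => conflict_free (C `|` A) /\ in_conflict_with D (C `|` A)
  | AfterLeft C D e | AfterRight C D e => en E C e
  end.

(** A [Call] frame has its own call recorded already, hence [C <> Ct]. After the left call only the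
    right subtree remains, where [e] is in [D], hence [~ Ct e]. After that only the cleanup is
    left. *)
Definition may_reach f : bool :=
  match f with
  | Call C D A => `[< [/\ C `<=` Ct, D `&` Ct = set0 & C <> Ct] >]
  | AfterLeft C D e => `[< [/\ C `<=` Ct, D `&` Ct = set0 & ~ Ct e] >]
  | AfterRight _ _ _ => false
  end.

Definition calls_on s : nat := count (fun C => `[< C = Ct >]) (calls s).

Definition invariant s : Prop :=
  all (fun f => `[< wf_frame f >]) (stack s) /\
  (calls_on s + count may_reach (stack s) <= 1)%N.

Lemma conflict_disjoint C C' D :
  conflict_free C' -> in_conflict_with D C' -> C `<=` C' -> D `&` C = set0.
Proof.
move=> free conf sub; apply/seteqP; split=> // x [/conf[y C'y xy] /sub C'x].
exact: free xy.
Qed.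

Lemma maximal_not_enabled C e : maximal_config E Ct -> en E C e -> C <> Ct.
Proof.
move=> [_ maxCt] [[_ nCe _] cCe] CE; apply: nCe.
have /seteqP[sub _] : C `|` [set e] = C.
  by rewrite [RHS]CE; apply: maxCt => //; rewrite -CE; left.
by apply: sub; right.
Qed.

(** If A is empty, the new union is C ∪ {e}, a configuration by enabledness; if [e] is in [A],
    moving it leaves C ∪ A unchanged. *)
Lemma wf_left C D A e : wf_frame (Call C D A) -> en E C e ->
  A = set0 \/ A e -> wf_frame (Call (C `|` [set e]) D (A `\ e)).
Proof.
move=> [free conf] [_ [_ _ _ free_e]] [A0|Ae] /=.
  rewrite A0 setU0 in conf; rewrite A0 set0D setU0; split=> // x /conf[y Cy xy].
  by exists y => //; left.
by rewrite -setUA setD1K.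
Qed.

Lemma wf_right U C D e J : Alt E U C (D `|` [set e]) J ->
  wf_frame (Call C (D `|` [set e]) (J `\` C)).
Proof.
move=> [_ _ [_ _ _ free] conf] /=; rewrite setUDr setDv setD0.
by split=> // x /conf[y [CJy [_ [xy _ _]]]]; exists y.
Qed.

(** The three terms exclude one another: the first two by whether C ∪ {e} is [Ct], the last by
    [~ Ct e]. Each one forces the parent frame to count. *)
Lemma may_reach_left C D A e : maximal_config E Ct ->
    wf_frame (Call (C `|` [set e]) D (A `\ e)) -> en E C e ->
  (`[< C `|` [set e] = Ct >] + may_reach (Call (C `|` [set e]) D (A `\ e))
     + may_reach (AfterLeft C D e) <= may_reach (Call C D A))%N.
Proof.
move=> maxCt [free conf] en_e; have nC := maximal_not_enabled maxCt en_e.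
have disj : D `&` (C `|` [set e]) = set0.
  by apply: conflict_disjoint free conf _; left.
have reach : C `<=` Ct -> D `&` Ct = set0 -> may_reach (Call C D A).
  by move=> sub dis; apply/asboolP; split.
rewrite [may_reach (Call (C `|` _) _ _)]/= [may_reach (AfterLeft _ _ _)]/=.
case: asboolP => [CeCt|nCe]; case: asboolP => [[sub dis ne]|_];
  case: asboolP => [[sub' dis' nCt]|_] //.
- by case: nCt; rewrite -CeCt; right.
- by rewrite reach // -CeCt // => x; left.
- by case: nCt; apply: sub; right.
- by rewrite reach // => x Cx; apply: sub; left.
- by rewrite reach.
Qed.

Lemma may_reach_right C D A e : maximal_config E Ct -> en E C e ->
  (`[< C = Ct >] + may_reach (Call C (D `|` [set e]) A)
     <= may_reach (AfterLeft C D e))%N.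
Proof.
move=> maxCt en_e /=.
(* The first term is 0: [C] can still be extended by [e]. *)
case: asboolP => [/(maximal_not_enabled maxCt en_e)//|_].
case: asboolP => // -[sub dis _].
have out x : (D `|` [set e]) x -> ~ Ct x.
  by move=> Dx Cx; have : (set0 : set X) x by rewrite -dis.
rewrite lt0b; apply/asboolP; split=> //; last by apply: out; right.
by apply/seteqP; split=> // x [Dx]; apply: out; left.
Qed.

Lemma invariant_start bot : ~ cf E bot bot -> invariant (start bot).
Proof.
move=> nbot; split=> /=.
  rewrite andbT; apply/asboolP; split=> // x y.
  by rewrite setU0 => -> ->.
(* If {bot} is [Ct], its call is counted and its frame is not. *)
by rewrite /calls_on /= !addn0; case: asboolP => // bCt; case: asboolP => // -[].
Qed.

Lemma invariant_step s s' : maximal_config E Ct ->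
  step E s s' -> invariant s -> invariant s'.
Proof.
move=> maxCt; case=> {s s'} /= [U G C D A k cs _|U G C D A k cs e [en_e _] Ae
  |U G C D e k cs J alt|U G C D e k cs _|U G C D e k cs] [];
  rewrite /invariant /calls_on /=.
- move=> /andP[_ wf] le1; split=> //; apply: leq_trans le1.
  by rewrite leq_add2l leq_addl.
- move=> /andP[/asboolP wfC wf] le1; have wfL := wf_left wfC en_e Ae.
  split; first by apply/and3P; split=> //; apply/asboolP.
  apply: leq_trans le1; rewrite -cats1 count_cat /= addn0 -!addnA leq_add2l.
  rewrite !addnA leq_add2r.
  exact: (may_reach_left maxCt wfL en_e).
- move=> /andP[/asboolP en_e wf] le1; split.
    by apply/and3P; split=> //; apply/asboolP => //; apply: wf_right alt.
  apply: leq_trans le1; rewrite -cats1 count_cat /= addn0 -addnA leq_add2l.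
  rewrite addnA leq_add2r.
  exact: (may_reach_right _ _ maxCt en_e).
- move=> /andP[wfe wf] le1; split; first by rewrite wfe.
  by apply: leq_trans le1; rewrite leq_add2l leq_addl.
- by move=> /andP[_ wf].
Qed.

Lemma invariant_execution bot s : maximal_config E Ct -> ~ cf E bot bot ->
  execution E bot s -> invariant s.
Proof.
move=> maxCt nbot; elim=> [|s1 s2 _ inv s12]; first exact: invariant_start.
exact: invariant_step s12 inv.
Qed.

End AtMostOnce.

Theorem theorem3 (T : choiceType) (M : system T) (I : rel T)
    (hI : unconditional_independence M I)
    (hfin : finite_set (ev (unfolding M I)))
    (Ct : set (event T)) (hmax : maximal_config (unfolding M I) Ct)
    (s : exploration (event T))
    (hs : execution (unfolding M I) Bot s) :
  (count (fun C : set (event T) => `[< C = Ct >]) (calls s) <= 1)%N.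
Proof.
(* Irreflexivity of conflict at [Bot] makes the initial frame well formed. *)
have [Isym _ _] := hI; have [_ _ _ [cf_irr _] _] := unfolding_is_les M Isym.
have [_ le1] := invariant_execution hmax (cf_irr Bot) hs.
exact: leq_trans (leq_addr _ _) le1.
Qed.
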